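(* Let $\lambda\in\mathbf{C}$ with $\lambda\neq 1$. For all integers $n\ge 0$ and $r\ge 1$, $$\frac{(r-1)!}{(1-\lambda)^{r-1}}S_\lambda(n,r-1)=\frac{(r-1)!}{(1-\lambda)^{r-1}}\,\frac{\tilde{\triangle}_\lambda^{r-1}0^n}{(r-1)!}$$ $$=\sum_{l=0}^{\min\{2r-1,n\}}\left\{\binom{n}{l}\sum_{m=0}^{l}\frac{\binom{2r-1}{m}}{(1-\lambda)^m}\sum_{\substack{k_1+\cdots+k_m=l\\ k_j\ge 1}}\binom{l}{k_1,\dots,k_m}\right\}H_{n-l}^{(r)}(\lambda)$$ $$\quad+\sum_{l=\min\{2r-1,n\}+1}^{n}\left\{\binom{n}{l}\sum_{m=0}^{\min\{2r-1,n\}}\frac{\binom{2r-1}{m}}{(1-\lambda)^m}\sum_{\substack{k_1+\cdots+k_m=l\\ k_j\ge 1}}\binom{l}{k_1,\dots,k_m}\right\}H_{n-l}^{(r)}(\lambda).$$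
   Context: The Frobenius-Euler numbers of order $r$ ($r$ a nonnegative integer), $H_n^{(r)}(\lambda)$, are defined by the formal power series identity $\left(\frac{1-\lambda}{e^t-\lambda}\right)^r=\sum_{n=0}^\infty H_n^{(r)}(\lambda)\frac{t^n}{n!}$. The analogue of the Stirling numbers of the second kind is $S_\lambda(n,k)=\frac{1}{k!}\sum_{j=0}^{k}\binom{k}{j}(-\lambda)^{k-j}j^n$ for $n,k\ge 0$, with $0^0=1$. The operator $\tilde{\triangle}_\lambda$ acts on functions by $\tilde{\triangle}_\lambda f(x)=f(x+1)-\lambda f(x)$, and $\tilde{\triangle}_\lambda^k0^n$ denotes the value at $x=0$ of $\tilde{\triangle}_\lambda^k$ applied to $f(x)=x^n$. The innermost sums run over $m$-tuples $(k_1,\dots,k_m)$ of positive integers with sum $l$, and $\binom{l}{k_1,\dots,k_m}=\frac{l!}{k_1!\cdots k_m!}$. For $m=0$ the innermost sum equals $1$ if $l=0$ and $0$ if $l\ge 1$. A sum whose lower limit exceeds its upper limit is $0$. *)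

(* Defs.v *)
From HB Require Import structures.
From mathcomp Require Import all_boot all_order all_algebra.
From mathcomp Require Import complex reals.
Set Implicit Arguments.
Unset Strict Implicit.
Unset Printing Implicit Defensive.
Import Order.TTheory GRing.Theory Num.Theory.
Local Open Scope ring_scope.

(* A formal power series \sum_n a n * t^n is its coefficient sequence. *)
Definition fps (F : numFieldType) := nat -> F.

Definition fps_const (F : numFieldType) (c : F) : fps F :=
  fun n => if n == 0%N then c else 0.

Definition fps_exp (F : numFieldType) : fps F := fun n => (n`!)%:R^-1.

Definition fps_sub (F : numFieldType) (a b : fps F) : fps F :=
  fun n => a n - b n.

Definition fps_mul (F : numFieldType) (a b : fps F) : fps F :=
  fun n => \sum_(i < n.+1) a i * b (n - i)%N.

Definition fps_pow (F : numFieldType) (a : fps F) (r : nat) : fps F :=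
  iter r (fps_mul a) (fps_const 1).

(* The first n coefficients of 1 / a, obtained by solving
   \sum_(i <= k) b i * a (k - i) = [k = 0] successively for k = 0, 1, ... *)
Fixpoint fps_inv_seq (F : numFieldType) (a : fps F) (n : nat) : seq F :=
  if n is k.+1 then
    let s := fps_inv_seq a k in
    rcons s (((k == 0%N)%:R - \sum_(i < k) s`_i * a (k - i)%N) / a 0%N)
  else [::].

Definition fps_inv (F : numFieldType) (a : fps F) : fps F :=
  fun n => (fps_inv_seq a n.+1)`_n.

Definition fps_div (F : numFieldType) (a b : fps F) : fps F :=
  fps_mul a (fps_inv b).

Lemma size_fps_inv_seq (F : numFieldType) (a : fps F) n :
  size (fps_inv_seq a n) = n.
Proof. by elim: n => //= n IHn; rewrite size_rcons IHn. Qed.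

Lemma nth_fps_inv_seq (F : numFieldType) (a : fps F) n i :
  (i < n)%N -> (fps_inv_seq a n)`_i = fps_inv a i.
Proof.
elim: n => // n IHn; rewrite ltnS leq_eqVlt => /orP[/eqP -> // | lt_in].
by rewrite /= nth_rcons size_fps_inv_seq lt_in IHn.
Qed.

Lemma fps_invE (F : numFieldType) (a : fps F) n :
  fps_inv a n =
  ((n == 0%N)%:R - \sum_(i < n) fps_inv a i * a (n - i)%N) / a 0%N.
Proof.
rewrite {1}/fps_inv /= nth_rcons size_fps_inv_seq ltnn eqxx.
by under eq_bigr => i _ do rewrite nth_fps_inv_seq //.
Qed.

Lemma fps_mulV (F : numFieldType) (a : fps F) :
  a 0%N != 0 -> fps_mul a (fps_inv a) =1 fps_const 1.
Proof.
move=> a0 n; rewrite /fps_mul (reindex_inj rev_ord_inj) /=.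
under eq_bigr => i _.
  rewrite subSS subKn; last by rewrite -ltnS.
  rewrite mulrC; over.
rewrite big_ord_recr /= subnn [fps_inv a n]fps_invE divfK // addrC subrK.
by rewrite /fps_const; case: eqP.
Qed.

Definition frobenius_euler_gf (F : numFieldType) (lambda : F) (r : nat) :
    fps F :=
  fps_pow
    (fps_div (fps_const (1 - lambda))
             (fps_sub (fps_exp F) (fps_const lambda))) r.

(* H_n^{(r)}(lambda); meaningful for lambda != 1, when e^t - lambda is
   invertible. *)
Definition frobenius_euler (F : numFieldType) (lambda : F) (r n : nat) : F :=
  (n`!)%:R * frobenius_euler_gf lambda r n.

Lemma frobenius_eulerE (F : numFieldType) (lambda : F) r n :
  frobenius_euler_gf lambda r n = frobenius_euler lambda r n / (n`!)%:R.
Proof. by rewrite mulrAC divff ?mul1r // pnatr_eq0 -lt0n fact_gt0. Qed.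

Definition stirling_lambda (F : numFieldType) (lambda : F) (n k : nat) : F :=
  (k`!)%:R^-1 *
  \sum_(j < k.+1) ('C(k, j))%:R * (- lambda) ^+ (k - j) * j%:R ^+ n.

Definition diff_lambda (F : numFieldType) (lambda : F) (f : F -> F) : F -> F :=
  fun x => f (x + 1) - lambda * f x.

Definition diff_lambda_zero_pow (F : numFieldType) (lambda : F) (k n : nat) :
    F :=
  iter k (diff_lambda lambda) (fun x => x ^+ n) 0.

(* The parts of a composition of l are at most l, so m-tuples over 'I_l.+1
   suffice. *)
Definition multinomial_sum (F : numFieldType) (m l : nat) : F :=
  \sum_(k : {ffun 'I_m -> 'I_l.+1} |
        [forall j, (0 < k j)%N] && ((\sum_j k j)%N == l))
    (l`!)%:R / \prod_j ((k j)`!)%:R.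

(* Main.v *)
Require Import Defs.
From HB Require Import structures.
From mathcomp Require Import all_boot all_order all_algebra.
From mathcomp Require Import complex reals.
From mathcomp Require Import ring.
Set Implicit Arguments.
Unset Strict Implicit.
Unset Printing Implicit Defensive.
Import Order.TTheory GRing.Theory Num.Theory.
Local Open Scope ring_scope.
Local Open Scope complex_scope.

(** Write [E] for [e^t] and [U] for [(E - lambda) / (1 - lambda)], so that the
    generating function of the numbers [H_n^(r)] is [U^-r].  The theorem is
    the coefficient of [t^n / n!] in the identity
    [[
       U^(r - 1) = U^(2r - 1) * U^-r.
    ]]
    On the left, expanding [(E - lambda)^(r - 1)] in powers of [E] gives the
    difference [diff_lambda^(r - 1) 0^n] up to the factor [(1 - lambda)^(r - 1)]
    ([fps_pow_exp_sub_const]), and the closed form of an iterated difference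
    ([iter_diff_lambda]) also identifies it with the Stirling number.  On the
    right, [U = 1 + (E - 1) / (1 - lambda)], so the binomial theorem expands
    [U^(2r - 1)] in powers of [E - 1], and the coefficients of [(E - 1)^m] are
    the sums of multinomial coefficients over compositions into [m] parts
    ([fps_pow_exp_sub1]).

    A composition of [l] has at most [l] parts, and ['C(2r - 1, m)] vanishes
    for [m > 2r - 1]; the two ranges of [m] in the theorem keep exactly the
    terms that survive both constraints.

    Power series are handled through polynomials that agree with them up to a
    fixed degree ([truncates]), where the ring structure of polynomials makes
    the binomial theorem and the distributivity of products over sums
    available. *)

(** * Polynomial truncations of power series *)

(** The coefficients of [p] beyond degree [N] are left unconstrained, so that
    the relation is stable under products without truncating again. *)
Definition truncates (F : numFieldType) (N : nat) (a : fps F) (p : {poly F}) :=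
  forall i, (i <= N)%N -> p`_i = a i.

Lemma truncates_poly (F : numFieldType) N (a : fps F) :
  truncates N a (\poly_(i < N.+1) a i).
Proof. by move=> i le_iN; rewrite coef_poly ltnS le_iN. Qed.

Lemma truncates_const (F : numFieldType) N (c : F) :
  truncates N (fps_const c) c%:P.
Proof. by move=> i _; rewrite coefC. Qed.

Lemma truncates_sub (F : numFieldType) N (a b : fps F) p q :
  truncates N a p -> truncates N b q -> truncates N (fps_sub a b) (p - q).
Proof. by move=> ap bq i le_iN; rewrite coefB ap ?bq. Qed.

Lemma truncates_mul (F : numFieldType) N (a b : fps F) p q :
  truncates N a p -> truncates N b q -> truncates N (fps_mul a b) (p * q).
Proof.
move=> ap bq i le_iN; rewrite coefM; apply: eq_bigr => j _.
have le_ji : (j <= i)%N by rewrite -ltnS.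
by rewrite ap ?(leq_trans le_ji) // bq // (leq_trans (leq_subr _ _)).
Qed.

Lemma truncates_pow (F : numFieldType) N (a : fps F) p m :
  truncates N a p -> truncates N (fps_pow a m) (p ^+ m).
Proof.
move=> ap; elim: m => [|m IHm]; first by rewrite expr0; apply: truncates_const.
by rewrite exprS; apply: truncates_mul.
Qed.

Lemma truncates_eq (F : numFieldType) N (a b : fps F) p :
  truncates N a p -> a =1 b -> truncates N b p.
Proof. by move=> ap eq_ab i le_iN; rewrite ap ?eq_ab. Qed.

Lemma fps_mul_constl (F : numFieldType) (c : F) (a : fps F) :
  fps_mul (fps_const c) a =1 (fun i => c * a i).
Proof.
move=> i; rewrite /fps_mul big_ord_recl subn0 big1 ?addr0 // => j _.
by rewrite mul0r.
Qed.

(** A series and its inverse truncate to polynomials whose product is only [1]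
    up to degree [N]; this is how such a product is cancelled. *)
Lemma coef_mul_truncates1 (F : numFieldType) N (p q : {poly F}) i :
  truncates N (fps_const 1) p -> (i <= N)%N -> (p * q)`_i = q`_i.
Proof.
move=> p1 le_iN.
have qq : truncates N (fun j => q`_j) q by [].
by rewrite (truncates_mul p1 qq) // fps_mul_constl mul1r.
Qed.

Lemma truncates1_pow (F : numFieldType) N (p : {poly F}) m :
  truncates N (fps_const 1) p -> truncates N (fps_const 1) (p ^+ m).
Proof.
move=> p1; elim: m => [|m IHm i le_iN]; first exact: truncates_const.
by rewrite exprS (coef_mul_truncates1 _ p1) // IHm.
Qed.

(** * Iterated lambda-differences and powers of the exponential series *)

Lemma natf_fact_neq0 (F : numFieldType) n : (n`!)%:R != 0 :> F.
Proof. by rewrite pnatr_eq0 -lt0n fact_gt0. Qed.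

Lemma bin_div_fact (F : numFieldType) n k : (k <= n)%N ->
  ('C(n, k))%:R / (n`!)%:R = (k`!)%:R^-1 / ((n - k)`!)%:R :> F.
Proof.
move=> le_kn; rewrite -(bin_fact le_kn) !natrM invfM mulrA.
rewrite divff ?mul1r ?invfM //.
by rewrite pnatr_eq0 -lt0n bin_gt0.
Qed.

(** The difference is [T - lambda] for the unit shift [T], which commutes with
    the scalar [lambda], so this is the binomial theorem for operators. *)
Lemma iter_diff_lambda (F : numFieldType) (lambda : F) (f : F -> F) k x :
  iter k (diff_lambda lambda) f x =
  \sum_(j < k.+1) ('C(k, j))%:R * (- lambda) ^+ (k - j) * f (x + j%:R).
Proof.
elim: k x => [|k IHk] x; first by rewrite big_ord1 bin0 subnn !mul1r addr0.
rewrite iterS /diff_lambda !IHk.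
rewrite [RHS]big_ord_recl /= subn0 bin0 mul1r.
under [in RHS]eq_bigr => j _ do
  rewrite /bump add1n subSS binS natrD mulrDl mulrDl.
rewrite big_split addrA [RHS]addrC /=; congr (_ + _).
  by apply: eq_bigr => j _; rewrite -[in RHS]natr1 -addrA [1 + _]addrC.
(* The index [j = k.+1], where the binomial coefficient vanishes, is added on
   the right so that both sums range over the same indices. *)
transitivity (\sum_(j < k.+2)
    ('C(k, j))%:R * (- lambda) ^+ (k.+1 - j) * f (x + j%:R)); last first.
  by rewrite big_ord_recl bin0 subn0 mul1r.
rewrite [RHS]big_ord_recr /= (bin_small (ltnSn k)) !mul0r addr0 big_distrr /=.
rewrite -sumrN.
apply: eq_bigr => j _; rewrite subSn -1?ltnS // exprS; ring.
Qed.

Lemma stirling_lambda_diff (F : numFieldType) (lambda : F) n k :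
  stirling_lambda lambda n k = diff_lambda_zero_pow lambda k n / (k`!)%:R.
Proof.
rewrite /stirling_lambda /diff_lambda_zero_pow iter_diff_lambda mulrC.
by under [in RHS]eq_bigr => j _ do rewrite add0r.
Qed.

(** This is [(e^t)^j = e^(jt)], truncated. *)
Lemma coef_exp_pow (F : numFieldType) N (p : {poly F}) j i :
  truncates N (fps_exp F) p -> (i <= N)%N ->
  (p ^+ j)`_i = j%:R ^+ i / (i`!)%:R.
Proof.
move=> pE; elim: j i => [|j IHj] i le_iN.
  by rewrite expr0 coef1 expr0n; case: eqP => [->|_]; rewrite ?divr1 ?mul0r.
rewrite exprSr coefM -natr1 [_ + 1]addrC exprDn mulr_suml.
apply: eq_bigr => k _.
have le_ki : (k <= i)%N by rewrite -ltnS.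
rewrite IHj ?(leq_trans le_ki) // pE ?(leq_trans (leq_subr _ _)) //.
by rewrite expr1n mul1r -[in RHS]mulr_natr -!mulrA bin_div_fact.
Qed.

(** Both sides are the binomial expansion with [E^j] in the place of the [j]-th
    power of the shift: [n!] times the coefficient of [E^j] at [t^n] is [j^n],
    which is the value at [0] of [x^n] shifted by [j]. *)
Lemma fps_pow_exp_sub_const (F : numFieldType) (lambda : F) k n :
  fps_pow (fps_sub (fps_exp F) (fps_const lambda)) k n =
  diff_lambda_zero_pow lambda k n / (n`!)%:R.
Proof.
have EE := @truncates_poly F n (fps_exp F).
have := truncates_pow k (truncates_sub EE (@truncates_const F n lambda)).
move=> <- //; move: (\poly_(i < _) _) EE => E EE.
rewrite addrC -polyCN exprDn coef_sum /diff_lambda_zero_pow iter_diff_lambda.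
rewrite mulr_suml; apply: eq_bigr => j _.
rewrite coefMn -polyC_exp coefCM (coef_exp_pow _ EE) // add0r.
by rewrite -!mulrA mulr_natl.
Qed.

(** * Powers of [e^t - 1] and compositions *)

(** Truncating at degree [l] itself makes the exponents range over ['I_l.+1],
    so that distributing the product over the sum yields the finite functions
    of [multinomial_sum]. *)
Lemma fps_pow_exp_sub1 (F : numFieldType) m l :
  fps_pow (fps_sub (fps_exp F) (fps_const 1)) m l =
  multinomial_sum F m l / (l`!)%:R.
Proof.
(* The factor [0 < i] removes the constant term of [e^t]; it will become the
   positivity condition on the parts. *)
pose p : {poly F} := \sum_(i < l.+1) ((0 < i)%N%:R / (i`!)%:R) *: 'X^i.
have pE : truncates l (fps_sub (fps_exp F) (fps_const 1)) p.
  move=> i le_il; rewrite /p.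
  rewrite -(poly_def l.+1 (fun i => (0 < i)%N%:R / (i`!)%:R)).
  rewrite coef_poly ltnS le_il /fps_sub /fps_exp /fps_const.
  by case: i {le_il} => [|i]; rewrite /= ?mul0r ?invr1 ?subrr // mul1r subr0.
rewrite -(truncates_pow m pE) //.
have -> : p ^+ m = \prod_(j < m) p by rewrite prodr_const card_ord.
rewrite /p bigA_distr_bigA coef_sum /multinomial_sum mulr_suml [RHS]big_mkcond.
apply: eq_bigr => k _ /=.
rewrite scaler_prod prodrXr coefZ coefXn eq_sym.
case: (_ == l); last by rewrite andbF mulr0.
rewrite andbT mulr1; case: forallP => [k_gt0 | k_not_gt0].
  under eq_bigr => j _ do rewrite k_gt0.
  by rewrite prodf_div big1 // mulrAC divff ?natf_fact_neq0.
have [j kj0] : exists j, ~~ (0 < k j)%N.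
  by apply/existsP; rewrite -negb_forall; apply/negP => /forallP.
by rewrite (bigD1 j) //= (negbTE kj0) !mul0r.
Qed.

Lemma multinomial_sum_eq0 (F : numFieldType) m l :
  (l < m)%N -> multinomial_sum F m l = 0.
Proof.
move=> lt_lm; apply: big1 => k /andP[/forallP k_gt0 /eqP sum_k].
suff : (m <= l)%N by rewrite leqNgt lt_lm.
rewrite -sum_k -[X in (X <= _)%N]card_ord -sum1_card.
by apply: leq_sum => j _; apply: k_gt0.
Qed.

(** * The generating function identity *)

(** The identity [U^(2r - 1) * U^-r = U^(r - 1)], with [U^(2r - 1)] expanded in
    powers of [(e^t - 1) / (1 - lambda)]; the number [s] stands for [r - 1], so
    that no exponent is a subtraction. *)
Lemma frobenius_euler_convolution (F : numFieldType) (lambda : F) n s :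
  lambda != 1 ->
  diff_lambda_zero_pow lambda s n / (1 - lambda) ^+ s =
  \sum_(0 <= l < n.+1) 'C(n, l)%:R
    * (\sum_(0 <= m < (s.+1 + s).+1)
         'C(s.+1 + s, m)%:R / (1 - lambda) ^+ m * multinomial_sum F m l)
    * frobenius_euler lambda s.+1 (n - l).
Proof.
move=> lambda1; have d0 : 1 - lambda != 0 by rewrite subr_eq0 eq_sym.
set d := 1 - lambda in d0 *.
pose b := fps_sub (fps_exp F) (fps_const lambda).
have b0 : b 0%N != 0 by rewrite /b /fps_sub /fps_exp /fps_const invr1.
have EE := @truncates_poly F n (fps_exp F).
move: (\poly_(i < _) _) EE => E EE.
have VE := @truncates_poly F n (fps_inv b).
move: (\poly_(i < _) _) VE => V VE.
have BE := truncates_sub EE (@truncates_const F n lambda).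
(* [E] and [V] stand for [e^t] and [(e^t - lambda)^-1]; thus [U] and [G] are
   inverse to each other only up to degree [n]. *)
pose G := d%:P * V; pose U := d^-1 *: (E - lambda%:P).
have GE : truncates n (frobenius_euler_gf lambda s.+1) (G ^+ s.+1).
  apply: truncates_pow; apply: (truncates_mul _ VE); exact: truncates_const.
have UG1 : truncates n (fps_const 1) (U * G).
  have -> : U * G = (E - lambda%:P) * V.
    by rewrite /U /G -scalerAl mulrCA mul_polyC scalerA mulVf // scale1r.
  exact: truncates_eq (truncates_mul BE VE) (fps_mulV b0).
have U_s : (U ^+ s)`_n = diff_lambda_zero_pow lambda s n / d ^+ s / n`!%:R.
  rewrite exprZn coefZ (truncates_pow s BE) // fps_pow_exp_sub_const exprVn.
  by rewrite mulrA [_^-1 * _]mulrC.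
have U_sum : U = 1 + d^-1 *: (E - 1%:P).
  have -> : 1 = d^-1 *: d%:P :> {poly F} by rewrite -mul_polyC -polyCM mulVf.
  by rewrite -scalerDr /d polyCB; congr (_ *: _); ring.
have U_pow l : (l <= n)%N -> (U ^+ (s.+1 + s))`_l =
    (\sum_(0 <= m < (s.+1 + s).+1)
       'C(s.+1 + s, m)%:R / d ^+ m * multinomial_sum F m l) / l`!%:R.
  move=> le_ln; rewrite U_sum exprDn coef_sum big_mkord mulr_suml.
  apply: eq_bigr => m _.
  have E1E := truncates_pow m (truncates_sub EE (@truncates_const F n 1)).
  rewrite expr1n mul1r exprZn coefMn coefZ E1E // fps_pow_exp_sub1 exprVn.
  by rewrite -!mulrA mulr_natl.
have n0 := natf_fact_neq0 F n.
(* [U^s = (U G)^(s + 1) U^s], regrouped as [U^(2s + 1) G^(s + 1)]. *)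
rewrite -[LHS](divfK n0) -U_s.
rewrite -(coef_mul_truncates1 _ (truncates1_pow s.+1 UG1)) //.
rewrite exprMn mulrAC -exprD coefM big_mkord mulr_suml; apply: eq_bigr => l _.
have le_ln : (l <= n)%N by rewrite -ltnS.
rewrite U_pow // GE ?leq_subr // frobenius_eulerE.
have := bin_div_fact F le_ln.
move/(canRL (divfK n0)) => ->; ring.
Qed.

Theorem theorem6 (R : realType) (lambda : R[i]) (hlambda : lambda != 1)
    (n r : nat) (hr : (1 <= r)%N) :
  ((r - 1)`!)%:R / (1 - lambda) ^+ (r - 1) * stirling_lambda lambda n (r - 1)
  = ((r - 1)`!)%:R / (1 - lambda) ^+ (r - 1)
    * (diff_lambda_zero_pow lambda (r - 1) n / ((r - 1)`!)%:R)
  /\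
  ((r - 1)`!)%:R / (1 - lambda) ^+ (r - 1)
    * (diff_lambda_zero_pow lambda (r - 1) n / ((r - 1)`!)%:R)
  = \sum_(0 <= l < (minn (2 * r - 1) n).+1)
      (('C(n, l))%:R
       * \sum_(0 <= m < l.+1)
           ('C(2 * r - 1, m))%:R / (1 - lambda) ^+ m * multinomial_sum _ m l)
      * frobenius_euler lambda r (n - l)
    + \sum_((minn (2 * r - 1) n).+1 <= l < n.+1)
      (('C(n, l))%:R
       * \sum_(0 <= m < (minn (2 * r - 1) n).+1)
           ('C(2 * r - 1, m))%:R / (1 - lambda) ^+ m * multinomial_sum _ m l)
      * frobenius_euler lambda r (n - l).
Proof.
case: r hr => // s _; rewrite subSS subn0.
have -> : (2 * s.+1 - 1 = s.+1 + s)%N by rewrite mul2n -addnn addnS subSS subn0.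
set N := (s.+1 + s)%N.
have s0 := natf_fact_neq0 R[i] s.
split; first by rewrite stirling_lambda_diff.
have -> : s`!%:R / (1 - lambda) ^+ s
    * (diff_lambda_zero_pow lambda s n / s`!%:R) =
    diff_lambda_zero_pow lambda s n / (1 - lambda) ^+ s.
  by rewrite mulrACA [_ / s`!%:R]mulrC mulrACA divff // mul1r mulrC.
rewrite frobenius_euler_convolution // -/N.
have le_Nn : ((minn N n).+1 <= n.+1)%N by rewrite ltnS geq_minr.
rewrite (big_cat_nat _ le_Nn) //=; congr (_ + _); apply: eq_big_nat => l.
- rewrite ltnS leq_min => /and3P[_ le_lN _]; congr (_ * _ * _).
  (* Since [l <= N], cutting the sum at [m = l] drops only zero terms. *)
  rewrite (@big_cat_nat _ _ _ l.+1) //=.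
  rewrite [X in _ + X]big_nat_cond [X in _ + X]big1 ?addr0 //.
  by move=> m /andP[/andP[lt_lm _] _]; rewrite multinomial_sum_eq0 ?mulr0.
- (* The range of [l] is empty unless [N < n], and then [minn N n] is [N]. *)
  rewrite gtn_min ltnS => /andP[/orP[lt_Nl | lt_nl] le_ln].
    by rewrite (minn_idPl (leq_trans (ltnW lt_Nl) le_ln)).
  by rewrite leqNgt lt_nl in le_ln.
Qed.
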